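(* Let $k$ be a positive integer. Every smooth word of height $k$ over $\Sigma=\{1,2\}$ belongs to exactly one MRSE chain of height $k$; that is, the sets of members of the MRSE chains of height $k$ form a partition of $P^k(\varepsilon)$, the set of all smooth words of height $k$. Moreover, the number of MRSE chains of height $k$ is $|H^k| = 2\cdot 3^{k-1}$.
   Context: Let $\Sigma=\{1,2\}$ and $\Sigma^*$ the free monoid of finite words over $\Sigma$, with empty word $\varepsilon$. A run of a word is a maximal factor of consecutive identical letters. A finite word $w\in\Sigma^*$ is differentiable if neither $111$ nor $222$ occurs in it; its derivative $D(w)$ is the word whose $j$-th symbol is the length of the $j$-th run of $w$, where the first run and/or the last run of $w$ is discarded if it has length one (so $D(w)\in\Sigma^*$). A word $w$ is a smooth word ($C^\infty$-word) if it is arbitrarily often differentiable, i.e. $D^j(w)$ is defined and differentiable for all $j\ge 0$. The height $ht(w)$ of a nonempty smooth word $w$ is the smallest integer $k$ with $D^k(w)=\varepsilon$; the height of $\varepsilon$ is $0$. $P^k(\varepsilon)$ denotes the set of all smooth words of height $k$. For $u,w\in\Sigma^*$, write $u\prec w$ ($w$ is a simple right extension of $u$) if $w=u\alpha$ for some $\alpha\in\Sigma$. An MRSE (maximal right smooth extension) chain of height $k$ is a sequence $u_1\prec u_2\prec\cdots\prec u_m$ with all $u_i\in P^k(\varepsilon)$ such that there is no $v\in P^k(\varepsilon)$ with $v\prec u_1$ or $u_m\prec v$. $H^k$ denotes the set of all MRSE chains of height $k$. *)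

(* Defs.v *)
From mathcomp Require Import all_boot.
From mathcomp Require Import mathcomp_extra boolp classical_sets functions cardinality.

Set Implicit Arguments.
Unset Strict Implicit.
Unset Printing Implicit Defensive.

Local Open Scope classical_set_scope.

(* Letters are natural numbers, since the letters of a derivative are run
   lengths. Words over Sigma are the sequences satisfying [is_word]. *)
Definition Sigma : seq nat := [:: 1; 2].

Definition is_word (w : seq nat) : bool := all [in Sigma] w.

Definition cons_run (a : nat) (rs : seq (seq nat)) : seq (seq nat) :=
  if rs is r :: rs' then
    if ohead r == Some a then (a :: r) :: rs' else [:: a] :: rs
  else [:: [:: a]].

Definition runs (w : seq nat) : seq (seq nat) := foldr cons_run [::] w.

Definition trim_first (s : seq nat) : seq nat :=
  if s is 1 :: s' then s' else s.

Definition trim_last (s : seq nat) : seq nat := rev (trim_first (rev s)).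

Definition differentiable (w : seq nat) : bool :=
  [&& is_word w, ~~ infix [:: 1; 1; 1] w & ~~ infix [:: 2; 2; 2] w].

(* [D] is total; it is the derivative on differentiable words and is only
   meaningful there. A word that is a single run of length one has derivative
   [::]: trimming the empty sequence at the other end changes nothing. *)
Definition D (w : seq nat) : seq nat :=
  trim_last (trim_first (map size (runs w))).

Definition smooth : set (seq nat) :=
  [set w | forall j : nat, differentiable (iter j D w)].

Lemma size_runs w : size (runs w) <= size w.
Proof.
elim: w => //= a w IHw; rewrite /cons_run.
by case: (runs w) IHw => // r rs /=; case: ifP => //= _ /ltnW.
Qed.

Lemma sumn_runs w : sumn (map size (runs w)) = size w.
Proof.
elim: w => //= a w IHw; rewrite /cons_run -IHw.
by case: (runs w) => // r rs /=; case: ifP.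
Qed.

Lemma size_trim_first s : size (trim_first s) <= size s.
Proof. by case: s => [|[|[|n]] s] //=. Qed.

Lemma size_trim_last s : size (trim_last s) <= size s.
Proof. by rewrite /trim_last size_rev -(size_rev s) size_trim_first. Qed.

Lemma runs_pos w : all (fun r => 0 < size r) (runs w).
Proof.
elim: w => //= a w; rewrite /cons_run.
by case: (runs w) => //= r rs /andP[r0 rs0]; case: ifP => //= _; rewrite r0.
Qed.

Lemma size_D w : w != [::] -> size (D w) < size w.
Proof.
case: w => // a w _; rewrite /D; apply: leq_ltn_trans (size_trim_last _) _.
have := sumn_runs (a :: w); have := runs_pos (a :: w).
case: (runs (a :: w)) => //= r rs /andP[r0 rs0] <-.
have lt_rs : size rs <= sumn (map size rs).
  by elim: rs rs0 => //= r' rs IH /andP[r'0 /IH]; rewrite -add1n; apply: leq_add.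
case: (size r) r0 => [//|[|n]] _ /=; rewrite size_map.
  by rewrite add1n ltnS.
by rewrite !addSn !ltnS; apply: leq_trans lt_rs (leq_addl _ _).
Qed.

Lemma ex_iterD_nil w : exists k, iter k D w == [::].
Proof.
have [n] := ubnP (size w); elim: n w => // n IHn w le_w.
have [->|w0] := eqVneq w [::]; first by exists 0.
have [|k /eqP Hk] := IHn (D w); first exact: leq_trans (size_D w0) le_w.
by exists k.+1; rewrite iterSr Hk.
Qed.

Definition ht (w : seq nat) : nat := ex_minn (ex_iterD_nil w).

Definition P (k : nat) : set (seq nat) := [set w | smooth w /\ ht w = k].

Definition simple_right_ext (u w : seq nat) : bool :=
  has (fun a => w == rcons u a) Sigma.

Definition MRSE (k : nat) : set (seq (seq nat)) :=
  [set c | [/\ c != [::],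
               [set` c] `<=` P k,
               sorted simple_right_ext c
             & ~ exists v, P k v /\ (simple_right_ext v (head [::] c) \/
                                     simple_right_ext (last [::] c) v)]].

(* Main.v *)
(* A nonempty differentiable word is determined by its first letter a and its
   run lengths x, t, and its derivative drops x if x = 1 and the last entry of t
   if it is 1. If a word of height k+1 could be extended by both letters within
   that height, then its derivative u would admit the extensions u1 and u2 in
   height k; by induction a word has at most one extension of its own height.
   Hence a chain is determined by its first word, and it remains to count
   the words of height k without a predecessor of height k. Those of height
   k+1 arise from those of height k: a word u is the derivative of exactly one
   such word with x = 1 for each a, and, if u begins with 2, also of one with
   x = 2 for each a. Half of the resulting words begin with 2, so the number is
   multiplied by 2 (1 + 1/2) = 3 at each step, starting from the two such words
   1 and 2 of height 1. *)

Require Import Defs.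
From mathcomp Require Import all_boot.
From mathcomp Require Import mathcomp_extra boolp classical_sets functions cardinality.

Local Open Scope classical_set_scope.
Local Open Scope card_scope.

(** * Words and their run lengths *)

(** Inverse of run-length encoding for words beginning with [a]; [3 - a] exchanges the letters 1 and
    2. *)
Fixpoint unrun (a : nat) (s : seq nat) : seq nat :=
  if s is n :: s' then nseq n a ++ unrun (3 - a) s' else [::].

Definition run_lengths (w : seq nat) : seq nat := map size (runs w).
Arguments run_lengths : simpl never.

Lemma head_runs a w : exists r rs, runs (a :: w) = (a :: r) :: rs.
Proof.
rewrite /=; case: (runs w) => [|[|b r] rs] /=; try by eexists; eexists.
by case: eqP => [[->]|_]; eexists; eexists.
Qed.

Lemma run_lengths_cons a b w :
  run_lengths [:: a, b & w] =
    if a == b then (head 0 (run_lengths (b :: w))).+1 :: behead (run_lengths (b :: w))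
    else 1 :: run_lengths (b :: w).
Proof.
have [r [rs E]] := head_runs b w.
rewrite /run_lengths -[runs (a :: _)]/(cons_run a (runs (b :: w))) E /=.
by rewrite (inj_eq Some_inj) eq_sym; case: eqP.
Qed.

Lemma run_lengths_neq0 a w : run_lengths (a :: w) != [::].
Proof. by have [r [rs E]] := head_runs a w; rewrite /run_lengths E. Qed.

Lemma Sigma_cases {a} : a \in Sigma -> a = 1 \/ a = 2.
Proof. by rewrite !inE => /orP[]/eqP->; [left|right]. Qed.

Lemma Sigma_flip {a} : a \in Sigma -> 3 - a \in Sigma.
Proof. by case/Sigma_cases=> ->. Qed.

Lemma run_lengths_unrun a s :
  a \in Sigma -> is_word s -> run_lengths (unrun a s) = s.
Proof.
elim: s a => [|x s IH] a aS //= /andP[xS sw].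
have := IH _ (Sigma_flip aS) sw.
(* A letter put before a word that begins with the other letter opens a run of length one; for
   [x = 2] the same letter is then put in front once more. *)
have rec : run_lengths (a :: unrun (3 - a) s) = 1 :: s.
  rewrite -{2}(IH _ (Sigma_flip aS) sw).
  case: s sw {IH} => [|y s] // /andP[yS _].
  by case: (Sigma_cases yS) => ->; case: (Sigma_cases aS) => ->;
    rewrite /= run_lengths_cons.
by case: (Sigma_cases xS) => -> _ //=; rewrite run_lengths_cons eqxx rec.
Qed.

Lemma unrun_run_lengths w :
  is_word w -> unrun (head 1 w) (run_lengths w) = w.
Proof.
elim: w => [|a [|b w] IH] // /andP[aS bw].
have /= {}IH := IH bw.
rewrite run_lengths_cons; have bS : b \in Sigma by case/andP: bw.
case: eqP => [->|ne_ab].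
  have := run_lengths_neq0 b w; rewrite -{4}IH.
  by case: (run_lengths (b :: w)).
rewrite /= -[in RHS]IH; congr (_ :: unrun _ _).
by case: (Sigma_cases aS) ne_ab => ->; case: (Sigma_cases bS) => ->.
Qed.

(** Serves to detect a cube at the front of a word by its first run. *)
Lemma prefix_nseq n a w :
  prefix (nseq n.+1 a) w = (ohead w == Some a) && (n < head 0 (run_lengths w)).
Proof.
elim: w n => [|b w IH] n //.
rewrite /= (inj_eq Some_inj) eq_sym; case: eqP => [->|] //=.
case: n => [|n]; last first.
  rewrite IH; case: w {IH} => [|c w] //.
  rewrite run_lengths_cons /= (inj_eq Some_inj) eq_sym.
  by case: eqP => //=; rewrite andbF.
case: w {IH} => // c w.
by rewrite run_lengths_cons; case: ifP.
Qed.

Lemma all_le2_run_lengths w :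
  is_word w ->
  all (leq^~ 2) (run_lengths w) = ~~ infix [:: 1; 1; 1] w && ~~ infix [:: 2; 2; 2] w.
Proof.
elim: w => [|a w IH] // /andP[aS wS].
rewrite !infix_consl !negb_or andbACA -IH //.
rewrite -![[:: _; _; _]]/(nseq 3 _) !prefix_nseq.
(* A letter that joins the first run raises its length, so the bound on the new length implies the
   one on the old. *)
have -> : all (leq^~ 2) (run_lengths (a :: w)) =
   (head 0 (run_lengths (a :: w)) <= 2) && all (leq^~ 2) (run_lengths w).
  case: w {IH wS} => // b w; rewrite run_lengths_cons; case: ifP => // _ /=.
  by case: (run_lengths _) => //= -[|[|n]].
by case: (Sigma_cases aS) => ->; rewrite /= -leqNgt ?andbT.
Qed.

Lemma run_lengths_gt0 w : all (leq 1) (run_lengths w).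
Proof. by rewrite all_map; apply: runs_pos. Qed.

(** Run lengths are positive, so excluding cubes puts all of them in [Sigma]. *)
Lemma differentiable_run_lengths w :
  differentiable w = is_word w && is_word (run_lengths w).
Proof.
rewrite /differentiable; case ww: (is_word w) => //=.
rewrite -all_le2_run_lengths //; have := run_lengths_gt0 w.
by elim: (run_lengths w) => //= n s IH /andP[n0 /IH->]; case: n n0 => [|[|[|n]]].
Qed.

Lemma is_word_unrun a s : a \in Sigma -> is_word (unrun a s).
Proof.
elim: s a => //= n s IH a aS; rewrite /is_word all_cat all_nseq aS orbT /=.
exact: IH (Sigma_flip aS).
Qed.

Lemma differentiable_unrun a s :
  a \in Sigma -> is_word s -> differentiable (unrun a s).
Proof.
move=> aS sw.
by rewrite differentiable_run_lengths is_word_unrun // run_lengths_unrun.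
Qed.

Lemma differentiableE w :
  differentiable w -> w <> [::] ->
  exists a x t, [/\ a \in Sigma, x \in Sigma, is_word t & w = unrun a (x :: t)].
Proof.
rewrite differentiable_run_lengths => /andP[ww lw] w0.
have := unrun_run_lengths _ ww.
case: (run_lengths w) lw => [|x t]; first by move=> _ /esym.
move=> /andP[xS tw] E; exists (head 1 w), x, t; split=> //.
by case: w ww w0 {E} => //= a w /andP[].
Qed.

Lemma unrun_inj a x t a' x' t' :
  a \in Sigma -> x \in Sigma -> is_word t ->
  a' \in Sigma -> x' \in Sigma -> is_word t' ->
  unrun a (x :: t) = unrun a' (x' :: t') -> [/\ a = a', x = x' & t = t'].
Proof.
move=> aS xS tw aS' xS' tw' E.
have := congr1 run_lengths E.
rewrite !run_lengths_unrun //=; try exact/andP.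
case=> <- <-; split=> //.
by have := congr1 (head 0) E; case: (Sigma_cases xS) => ->; case: (Sigma_cases xS') => ->.
Qed.

(** * The derivative and the height in terms of run lengths *)

Lemma trim_last_rcons1 t : trim_last (rcons t 1) = t.
Proof. by rewrite /trim_last rev_rcons /= revK. Qed.

Lemma trim_last_rcons2 t : trim_last (rcons t 2) = rcons t 2.
Proof. by rewrite /trim_last rev_rcons /= -rev_rcons revK. Qed.

(** The factor [nseq (x == 2) 2] is [x] if it survives trimming and empty otherwise. A leading 2 is
    not trimmed from the right either, since only a 1 is, so the two ends separate. *)
Lemma D_unrun a x t :
  a \in Sigma -> x \in Sigma -> is_word t ->
  D (unrun a (x :: t)) = nseq (x == 2) 2 ++ trim_last t.
Proof.
move=> aS xS tw; rewrite /D -/(run_lengths _) run_lengths_unrun //; last exact/andP.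
case: (Sigma_cases xS) => -> //=.
elim/last_ind: t tw => // t y _; rewrite /is_word all_rcons => /andP[yS _].
by case: (Sigma_cases yS) => ->; rewrite -rcons_cons !(trim_last_rcons1, trim_last_rcons2).
Qed.

Lemma smoothD w : smooth w <-> differentiable w /\ smooth (D w).
Proof.
split=> [sw|[dw sw] [|j]] //; last by rewrite iterSr; apply: sw.
split; first exact: (sw 0).
by move=> j; rewrite -iterSr; apply: sw.
Qed.

Lemma ht_nil : ht [::] = 0.
Proof. by rewrite /ht; case: ex_minnP => m _ /(_ 0 isT); case: m. Qed.

Lemma htS w : w <> [::] -> ht w = (ht (D w)).+1.
Proof.
move=> w0; rewrite /ht; case: ex_minnP => m Hm minm; case: ex_minnP => n Hn minn.
apply/eqP; rewrite eqn_leq minm ?iterSr //=.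
by case: m Hm {minm} => [/eqP//|m]; rewrite iterSr ltnS => /minn.
Qed.

Lemma P0E w : P 0 w <-> w = [::].
Proof.
split=> [[_ h0]|->]; last by split; [elim=> // j; rewrite iterSr|exact: ht_nil].
by have [//|/eqP/htS] := eqVneq w [::]; rewrite h0.
Qed.

Lemma PSE k w : P k.+1 w <-> [/\ differentiable w, w <> [::] & P k (D w)].
Proof.
split=> [[/smoothD[dw sw] hw]|[dw w0 [sw hw]]].
  have w0 : w <> [::] by move=> w0; move: hw; rewrite w0 ht_nil.
  by split=> //; split=> //; move: hw; rewrite htS // => -[].
by split; [apply/smoothD|rewrite htS // hw].
Qed.

Lemma P_nil k : P k [::] -> k = 0.
Proof. by case=> _ <-; exact: ht_nil. Qed.

(** Reduces height [k.+1] to height [k]; the resulting condition does not depend on [a]. *)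
Lemma P_unrun k a x t :
  a \in Sigma -> x \in Sigma -> is_word t ->
  P k.+1 (unrun a (x :: t)) <-> P k (nseq (x == 2) 2 ++ trim_last t).
Proof.
move=> aS xS tw; rewrite -(D_unrun a) //; split=> [/PSE[]//|Pk].
apply/PSE; split=> //; first by apply: differentiable_unrun => //; apply/andP.
by case: (Sigma_cases xS) => ->.
Qed.

Lemma P_unrunE k w : P k.+1 w ->
  exists a x t, [/\ a \in Sigma, x \in Sigma, is_word t & w = unrun a (x :: t)].
Proof. by case/PSE=> dw w0 _; apply: differentiableE. Qed.

Lemma P_is_word k w : P k w -> is_word w.
Proof. by case=> /(_ 0)/and3P[]. Qed.

(** * Uniqueness of the right extension within a height *)

Lemma unrun_rcons1 a s : exists b, unrun a (rcons s 1) = rcons (unrun a s) b.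
Proof.
elim: s a => [|n s IH] a; first by exists a.
by have [b E] := IH (3 - a); exists b; rewrite /= E rcons_cat.
Qed.

Lemma unrun_rcons2 a s : exists b, unrun a (rcons s 2) = rcons (unrun a (rcons s 1)) b.
Proof.
elim: s a => [|n s IH] a; first by exists a.
by have [b E] := IH (3 - a); exists b; rewrite /= E rcons_cat.
Qed.

Lemma is_word_rcons w b : is_word (rcons w b) = (b \in Sigma) && is_word w.
Proof. exact: all_rcons. Qed.

(** The new letter either opens a run of length one or lengthens the last run from one to two. Equal
    heights exclude that the lengthened run is also the first. *)
Lemma P_rconsE k w b : P k.+1 w -> P k.+1 (rcons w b) ->
  exists a x t, [/\ a \in Sigma, x \in Sigma, is_word t &
    (w = unrun a (x :: t) /\ rcons w b = unrun a (x :: rcons t 1)) \/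
    (w = unrun a (x :: rcons t 1) /\ rcons w b = unrun a (x :: rcons t 2))].
Proof.
move=> Pw Pwb; have [a [x [t [aS xS tw E]]]] := P_unrunE _ _ Pwb.
case/lastP: t => [|t y] in tw E *.
  (* Here [rcons w b] is a single run. If [x = 1], then [w] is empty; if [x = 2], the derivatives
     are empty and [[:: 2]], which differ in height. *)
  have w0 : w = nseq x.-1 a.
    move: E; rewrite /= cats0; case: (Sigma_cases xS) => -> /=.
      by case: w {Pw Pwb} => [|? []].
    by case: w {Pw Pwb} => [|? [|? []]] //= [-> _].
  case: (Sigma_cases xS) => Ex; subst x.
    by move: Pw; rewrite w0 => /P_nil.
  move: Pwb; rewrite E => /P_unrun /= -/(_ aS xS isT) P2.
  move: Pw; rewrite w0 -[nseq _ _]/(unrun a [:: 1]) => /P_unrun /= -/(_ aS isT isT).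
  by move=> /P_nil k0; move: P2; rewrite k0 => /P0E.
move: tw; rewrite is_word_rcons => /andP[yS tw].
exists a, x, t; split=> //.
case: (Sigma_cases yS) => Ey; subst y; rewrite -rcons_cons in E *.
  left; split=> //; have [c Ec] := unrun_rcons1 a (x :: t).
  by move: E; rewrite Ec => /rcons_inj[].
right; split=> //; have [c Ec] := unrun_rcons2 a (x :: t).
by move: E; rewrite Ec => /rcons_inj[].
Qed.

Lemma P_rcons_inj k w b c : P k w -> P k (rcons w b) -> P k (rcons w c) -> b = c.
Proof.
elim: k w b c => [|k IH] w b c Pw Pb Pc; first by move/P0E: Pb; case: (w).
(* The mixed case: one letter opens a run, the other lengthens the last one. The derivative of [w]
   would then extend by both 1 and 2 within height [k]. *)
have no12 a x t a' x' t' : a \in Sigma -> x \in Sigma -> is_word t ->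
    a' \in Sigma -> x' \in Sigma -> is_word t' ->
    w = unrun a (x :: t) -> w = unrun a' (x' :: rcons t' 1) ->
    P k.+1 (unrun a (x :: rcons t 1)) -> P k.+1 (unrun a' (x' :: rcons t' 2)) -> False.
  move=> aS xS tw aS' xS' tw' Ew Ew'.
  have tw1 : is_word (rcons t' 1) by rewrite is_word_rcons.
  have tw2 : is_word (rcons t' 2) by rewrite is_word_rcons.
  have [<- <- Et] : [/\ a = a', x = x' & t = rcons t' 1].
    by apply: unrun_inj => //; rewrite -Ew.
  rewrite Et in Ew tw *.
  move/P_unrun => /(_ aS xS); rewrite is_word_rcons => /(_ tw).
  rewrite trim_last_rcons1 -rcons_cat => P1.
  move/P_unrun => /(_ aS xS tw2); rewrite trim_last_rcons2 -rcons_cat => P2.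
  move: Pw; rewrite Ew => /P_unrun -/(_ aS xS tw); rewrite trim_last_rcons1 => P0.
  by have := IH _ _ _ P0 P1 P2.
have [a [x [t [aS xS tw H]]]] := P_rconsE _ _ _ Pw Pb.
have [a' [x' [t' [aS' xS' tw' H']]]] := P_rconsE _ _ _ Pw Pc.
case: H H' => [[Ew Eb]|[Ew Eb]] [[Ew' Ec]|[Ew' Ec]].
- have [ea ex et] : [/\ a = a', x = x' & t = t'] by apply: unrun_inj => //; rewrite -Ew.
  by move: Ec; rewrite -ea -ex -et -Eb => /rcons_inj[].
- by case: (no12 a x t a' x' t') => //; rewrite -?Eb -?Ec.
- by case: (no12 a' x' t' a x t) => //; rewrite -?Eb -?Ec.
- have [ea ex /rcons_inj[et]] : [/\ a = a', x = x' & rcons t 1 = rcons t' 1].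
    by apply: unrun_inj; rewrite ?is_word_rcons // -Ew.
  by move: Ec; rewrite -ea -ex -et -Eb => /rcons_inj[].
Qed.

(** * Words without a predecessor of the same height *)

Definition chain_start (k : nat) (w : seq nat) : Prop :=
  P k w /\ forall v b, w = rcons v b -> ~ P k v.

(* The shortest preimage of v under [trim_last], provided v is a word over
   [Sigma]; the default 2 of [last] leaves the empty word unchanged. *)
Definition pad (v : seq nat) : seq nat := if last 2 v == 1 then rcons v 1 else v.

Lemma trim_last_pad v : is_word v -> trim_last (pad v) = v.
Proof.
rewrite /pad; case/lastP: v => // v y; rewrite is_word_rcons last_rcons => /andP[yS _].
by case: (Sigma_cases yS) => -> /=; rewrite (trim_last_rcons1, trim_last_rcons2).
Qed.

Lemma is_word_pad v : is_word v -> is_word (pad v).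
Proof. by rewrite /pad; case: ifP => //; rewrite is_word_rcons. Qed.

(** For nonempty [t], deleting the last letter of the word either keeps its derivative or deletes
    the last letter of the derivative. The condition on [pad] excludes the first case, in which the
    predecessor has the same height. *)
Lemma chain_start_unrun k a x t :
  a \in Sigma -> x \in Sigma -> is_word t ->
  chain_start k.+1 (unrun a (x :: t)) <->
  chain_start k (nseq (x == 2) 2 ++ trim_last t) /\ pad (trim_last t) = t.
Proof.
move=> aS xS tw.
have start_rcons j u v b : u = rcons v b -> (chain_start j u <-> P j u /\ ~ P j v).
  move=> ->; split=> [[Pu /(_ v b erefl)] //|[Pu nPv]].
  by split=> // v' b' /rcons_inj[<-].
have start_PE : P k.+1 (unrun a (x :: t)) <-> P k (nseq (x == 2) 2 ++ trim_last t).
  exact: P_unrun.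
case/lastP: t => [|t y] in tw start_PE *.
  (* For a single run, a predecessor of the same height, of the word or of its derivative, would
     have to be empty or have an empty derivative, which contradicts the heights. *)
  rewrite {2}/chain_start /chain_start /= cats0 in start_PE *.
  case: (Sigma_cases xS) => Ex; subst x.
    split=> [[/start_PE P1 _]|[[/start_PE P1 _] _]].
      by split=> //; split=> // -[].
    by split=> // -[|? []] // b _ /P_nil.
  split=> [[/start_PE P1 _]|[[/start_PE P1 _] _]]; move: (P1).
    move=> /start_PE P2; split=> //; split=> //.
    by move=> [|? [|? ?]] b // _ /P_nil k0; move: P1; rewrite k0 => /P0E.
  move=> /start_PE P2; split=> // -[|? [|? []]] // b.
  move=> [<- _]; rewrite -[[:: a]]/(unrun a [:: 1]) => /P_unrun -/(_ aS isT isT).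
  by move=> /P_nil k0; move: P2; rewrite k0 => /P0E.
move: (tw); rewrite is_word_rcons => /andP[yS tw'].
case: (Sigma_cases yS) => Ey; subst y.
  rewrite trim_last_rcons1 in start_PE *.
  have [b Eb] := unrun_rcons1 a (x :: t).
  rewrite (start_rcons _ _ _ _ Eb) start_PE P_unrun //.
  rewrite /pad; case/lastP: t => [|t z] in tw tw' Eb start_PE *.
    by split=> -[] //; case=> _ /eqP.
  move: (tw'); rewrite is_word_rcons last_rcons => /andP[zS tw''].
  case: (Sigma_cases zS) => Ez; subst z.
    rewrite eqxx trim_last_rcons1.
    rewrite -rcons_cat (start_rcons _ _ _ _ erefl).
    by split=> // -[].
  rewrite trim_last_rcons2; split=> -[] // _ /(congr1 size).
  by rewrite /= !size_rcons => /n_Sn.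
rewrite trim_last_rcons2 in start_PE *.
have [b Eb] := unrun_rcons2 a (x :: t).
rewrite (start_rcons _ _ _ _ Eb) start_PE rcons_cons P_unrun // ?is_word_rcons //.
rewrite trim_last_rcons1 /pad last_rcons -rcons_cat (start_rcons _ _ _ _ erefl).
by split=> [|[]].
Qed.

(** * Enumeration and number of the chain starts *)

(** Run lengths of the chain starts one level up: a leading 1 is the entry the derivative drops,
    while a leading 2 of [u] serves itself as the first run length. *)
Definition start_runs (l : seq (seq nat)) : seq (seq nat) :=
  [seq 1 :: pad u | u <- l] ++ [seq 2 :: pad (behead u) | u <- l & head 0 u == 2].

Fixpoint chain_starts (k : nat) : seq (seq nat) :=
  if k is j.+1 then [seq unrun a s | a <- Sigma, s <- start_runs (chain_starts j)]
  else [:: [::]].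
Arguments chain_starts : simpl never.

Lemma start_runsP x t l :
  reflect (exists v, [/\ nseq (x == 2) 2 ++ v \in l, x \in Sigma & t = pad v])
    (x :: t \in start_runs l).
Proof.
rewrite mem_cat; apply: (iffP orP) => [[]/mapP[u]|].
- by move=> ul [-> ->]; exists u.
- rewrite mem_filter => /andP[hu ul] [-> ->]; exists (behead u); split=> //.
  by case: u ul hu => //= y u ul /eqP<-.
case=> v [vl /Sigma_cases[]Ex ->]; subst x; first by left; apply/mapP; exists v.
by right; apply/mapP; exists (2 :: v) => //; rewrite mem_filter.
Qed.

Lemma chain_startsP k w : w \in chain_starts k <-> chain_start k w.
Proof.
elim: k w => [|k IH] w.
  rewrite inE; split=> [/eqP->|[/P0E->]//].
  by split; [apply/P0E|case].
split.
  move/allpairsP=> [[a s]] /= [aS + ->].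
  case: s => [|x t]; first by rewrite mem_cat => /orP[]/mapP[].
  move=> /start_runsP[v [/IH sv xS ->]].
  have vw : is_word v.
    by have [/P_is_word] := sv; rewrite /is_word all_cat => /andP[].
  apply/chain_start_unrun => //; first exact: is_word_pad.
  by rewrite trim_last_pad.
move=> sw; have [a [x [t [aS xS tw E]]]] := P_unrunE _ _ (proj1 sw).
move: sw; rewrite E => /chain_start_unrun -/(_ aS xS tw) [/IH sv Et].
apply/allpairsP; exists (a, x :: t); split=> //=.
by apply/start_runsP; exists (trim_last t).
Qed.

Lemma is_word_chain_starts k : all is_word (chain_starts k).
Proof. by apply/allP=> w /chain_startsP[/P_is_word]. Qed.

Lemma pad_inj : {in is_word &, injective pad}.
Proof. by move=> u v uw vw /(congr1 trim_last); rewrite !trim_last_pad. Qed.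

Lemma start_runs_word l s : all is_word l -> s \in start_runs l ->
  exists x t, [/\ s = x :: t, x \in Sigma & is_word t].
Proof.
move=> /allP lw; case: s => [|x t]; first by rewrite mem_cat => /orP[]/mapP[].
case/start_runsP=> v [/lw vl xS ->]; exists x, (pad v); split=> //.
by apply: is_word_pad; move: vl; rewrite /is_word all_cat => /andP[].
Qed.

Lemma uniq_start_runs l : all is_word l -> uniq l -> uniq (start_runs l).
Proof.
move=> /allP lw ul; rewrite cat_uniq; apply/and3P; split.
- by rewrite map_inj_in_uniq // => u v /lw uw /lw vw [/pad_inj]; apply.
- by apply/hasPn=> _ /mapP[u _ ->]; apply/mapP=> -[].
rewrite map_inj_in_uniq ?filter_uniq // => u v.
rewrite !mem_filter => /andP[hu /lw uw] /andP[hv /lw vw] [].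
case: u hu uw => // a u /= /eqP-> uw; case: v hv vw => // b v /= /eqP-> vw.
by move/pad_inj->.
Qed.

Lemma uniq_chain_starts k : uniq (chain_starts k).
Proof.
elim: k => // k IH; apply: allpairs_uniq => //.
  exact: uniq_start_runs (is_word_chain_starts k) IH.
move=> _ _ /allpairsP[[a s] [aS sl ->]] /allpairsP[[a' s'] [aS' sl' ->]].
move: aS aS' sl sl' => /= aS aS' sl sl'.
have [x [t [-> xS tw]]] := start_runs_word _ _ (is_word_chain_starts k) sl.
have [x' [t' [-> xS' tw']]] := start_runs_word _ _ (is_word_chain_starts k) sl'.
by case/unrun_inj=> // -> -> ->.
Qed.

(** The starts beginning with 2 are counted along, because they are the ones that contribute twice
    to [start_runs]. *)
Lemma size_chain_starts k :
  size (chain_starts k.+1) = 2 * 3 ^ k /\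
  count (fun w => head 0 w == 2) (chain_starts k.+1) = 3 ^ k.
Proof.
have headE j a : a \in Sigma ->
    count (fun w => head 0 w == 2)
      [seq unrun a s | s <- start_runs (chain_starts j)] =
    (a == 2) * size (start_runs (chain_starts j)).
  move=> aS; rewrite count_map.
  rewrite (eq_in_count (a2 := fun=> a == 2)) => [|s /=].
    by case: eqP; rewrite ?count_predT ?count_pred0 ?mul1n.
  case/(start_runs_word _ _ (is_word_chain_starts j))=> x [t [-> xS _]].
  by case: (Sigma_cases xS) => ->.
have recE j : size (chain_starts j.+1) = 2 * size (start_runs (chain_starts j)) /\
    count (fun w => head 0 w == 2) (chain_starts j.+1) =
      size (start_runs (chain_starts j)).
  split; first exact: size_allpairs.
  by rewrite /chain_starts -/chain_starts /= cats0 count_cat !headE //= mul0n mul1n.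
have [-> ->] := recE k.
suff -> : size (start_runs (chain_starts k)) = 3 ^ k by [].
(* The base is [start_runs [:: [::]] = [:: [:: 1]]]; the step adds [2 * 3 ^ k] and [3 ^ k]. *)
elim: k => // k IH; have [+ +] := recE k; rewrite IH => Es Ec.
by rewrite size_cat !size_map size_filter Es Ec expnS -mulSnr.
Qed.

(** * Existence and uniqueness of the chain through a word *)

Lemma P_bounded k : exists N, forall w, P k w -> size w <= N.
Proof.
elim: k => [|k [N HN]]; first by exists 0 => w /P0E->.
(* The derivative drops at most two run lengths, and each run has at most two letters. *)
exists (2 * N.+2) => w Pw; have [a [x [t [aS xS tw E]]]] := P_unrunE _ _ Pw.
have size_le s b : is_word s -> size (unrun b s) <= 2 * size s.
  elim: s b => //= y s IHs b /andP[yS sw].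
  rewrite size_cat size_nseq mulnS leq_add ?IHs //.
  by case: (Sigma_cases yS) => ->.
move: Pw; rewrite E => /P_unrun -/(_ aS xS tw) /HN szN.
apply: leq_trans (size_le _ _ _) _; first exact/andP.
rewrite leq_mul2l /= ltnS; move: szN; rewrite size_cat => /(leq_trans (leq_addl _ _)).
rewrite -ltnS; apply: leq_trans.
case/lastP: t tw {E} => // t y; rewrite is_word_rcons => /andP[yS _].
case: (Sigma_cases yS) => ->; rewrite (trim_last_rcons1, trim_last_rcons2) !size_rcons //.
Qed.

Lemma simple_right_extP v w :
  reflect (exists2 a, a \in Sigma & w = rcons v a) (simple_right_ext v w).
Proof.
by apply: (iffP hasP) => -[a aS]; [move/eqP|move=> ->]; exists a.
Qed.

Lemma P_simple_right_ext_inj k u v w :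
  P k u -> P k v -> P k w -> simple_right_ext u v -> simple_right_ext u w -> v = w.
Proof.
move=> Pu Pv Pw /simple_right_extP[a _ Ev] /simple_right_extP[b _ Ew]; subst v w.
by rewrite (P_rcons_inj _ _ _ _ Pu Pv Pw).
Qed.

Lemma simple_right_ext_inj u v w :
  simple_right_ext u w -> simple_right_ext v w -> u = v.
Proof.
by move=> /simple_right_extP[a _ ->] /simple_right_extP[b _ /rcons_inj[]].
Qed.

Lemma chain_startE k w : chain_start k w <->
  P k w /\ ~ exists v, P k v /\ simple_right_ext v w.
Proof.
split=> [[Pw nP]|[Pw nP]]; split=> //.
  by move=> [v [Pv /simple_right_extP[b _]]] /nP.
move=> v b E Pv; apply: nP; exists v; split=> //; apply/simple_right_extP; exists b => //.
by move/P_is_word: Pw; rewrite E is_word_rcons => /andP[].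
Qed.

Definition chain_end (k : nat) (w : seq nat) : Prop :=
  ~ exists v, P k v /\ simple_right_ext w v.

Lemma MRSE_cons k u s : MRSE k (u :: s) <->
  [/\ {in s, forall w, P k w}, path simple_right_ext u s,
      chain_start k u & chain_end k (last u s)].
Proof.
split=> [[_ sP su nE]|[sP su /chain_startE[Pu nS] nE]].
  split=> //.
  - by move=> w ws; apply: sP; rewrite /= inE ws orbT.
  - apply/chain_startE; split; first by apply: sP; rewrite /= inE eqxx.
    by move=> [v [Pv uv]]; apply: nE; exists v; split=> //; left.
  - by move=> [v [Pv uv]]; apply: nE; exists v; split=> //; right.
split=> //.
  by move=> w /=; rewrite inE => /orP[/eqP->|/sP].
by move=> [v [Pv []uv]]; [apply: nS|apply: nE]; exists v.
Qed.

(** Each next word is forced by uniqueness of the extension, and neither chain can stop before the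
    other because its last word is maximal. *)
Lemma MRSE_head_inj k c c' : MRSE k c -> MRSE k c' -> head [::] c = head [::] c' -> c = c'.
Proof.
case: c => [[]//|u s]; case: c' => [_ []//|u' s'].
move=> /MRSE_cons[sP su [Pu _] nE] /MRSE_cons[sP' su' _ nE'] /= Eu; subst u'.
congr cons; elim: s s' u sP su Pu nE sP' su' nE' => [|v s IH] [|v' s'] u //=.
- move=> _ _ _ nE sP' /andP[uv' _] _; case: nE; exists v'; split=> //.
  by apply: sP'; rewrite inE eqxx.
- move=> sP /andP[uv _] _ _ _ _ nE'; case: nE'; exists v; split=> //.
  by apply: sP; rewrite inE eqxx.
move=> sP /andP[uv vs] Pu nE sP' /andP[uv' vs'] nE'.
have Pv : P k v by apply: sP; rewrite inE eqxx.
have Pv' : P k v' by apply: sP'; rewrite inE eqxx.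
have Ev := P_simple_right_ext_inj _ _ _ _ Pu Pv Pv' uv uv'; subst v'.
congr cons; apply: (IH _ v) => // w ws; [apply: sP|apply: sP'];
  by rewrite inE ws orbT.
Qed.

Lemma path_pred (T : eqType) (e : rel T) x s y : path e x s -> y \in s ->
  exists2 z, z \in x :: s & e z y.
Proof.
elim: s x => //= z s IH x /andP[xz zs]; rewrite inE => /orP[/eqP->|ys].
  by exists x; rewrite ?inE ?eqxx.
by have [t ts ty] := IH _ zs ys; exists t; rewrite // inE ts orbT.
Qed.

(** Walking back from [w], both chains pass through the same words, since a predecessor arises by
    deleting the last letter. They reach their heads together, as a head has no predecessor of its
    height. *)
Lemma MRSE_mem_head k c c' w : MRSE k c -> MRSE k c' -> w \in c -> w \in c' ->
  head [::] c = head [::] c'.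
Proof.
have aux d : MRSE k d -> forall x, x \in d ->
    (chain_start k x /\ x = head [::] d) \/
    (exists v, [/\ v \in d, P k v & simple_right_ext v x]).
  case: d => // u s ms; have [_ sP _ _] := ms.
  move/MRSE_cons: ms => [_ us su _] x; rewrite inE => /orP[/eqP->|]; first by left.
  by case/(path_pred _ _ _ _ _ us)=> v vs vx; right; exists v; split=> //; apply: sP.
move=> mc mc'; have [n] := ubnP (size w); elim: n w => // n IH w szw wc wc'.
case: (aux _ mc _ wc) => [[sw <-]|[v [vc Pv vw]]];
  case: (aux _ mc' _ wc') => [[sw' <-]|[v' [vc' Pv' vw']]] //.
- by case/chain_startE: sw => _ []; exists v'.
- by case/chain_startE: sw' => _ []; exists v.
have Ev := simple_right_ext_inj _ _ _ vw vw'; subst v'.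
apply: (IH v) => //.
by case/simple_right_extP: vw szw => b _ ->; rewrite size_rcons.
Qed.

Lemma chain_end_exists k w : P k w -> exists s,
  [/\ {in s, forall w, P k w}, path simple_right_ext w s & chain_end k (last w s)].
Proof.
have [N HN] := P_bounded k.
(* Extending to the right terminates because [N] bounds the length. *)
have [n] := ubnP (N - size w); elim: n w => // n IH w szw Pw.
have [[v [Pv wv]]|nE] := pselect (exists v, P k v /\ simple_right_ext w v); last first.
  by exists [::].
have [|s [sP vs sE]] := IH v _ Pv.
  have := HN _ Pv; case/simple_right_extP: wv => b _ ->; rewrite size_rcons => szN.
  by move: szw; rewrite ltnS; apply: leq_trans; rewrite ltn_sub2l.
exists (v :: s); split=> //=; last exact/andP.
by move=> x; rewrite inE => /orP[/eqP->|/sP].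
Qed.

Lemma MRSE_exists k w : P k w -> exists2 c, MRSE k c & w \in c.
Proof.
move=> Pw; have [s [sP ws sE]] := chain_end_exists _ _ Pw.
(* Generalised to any sequence that is maximal on the right, so that predecessors can be put in
   front; this ends because they get shorter. *)
suff [c mc /(_ w)] : exists2 c, MRSE k c & {subset w :: s <= c}.
  by rewrite inE eqxx => /(_ isT); exists c.
have [n] := ubnP (size w); elim: n w s Pw sP ws sE => // n IH w s Pw sP ws sE szw.
have [[v [Pv vw]]|nS] := pselect (exists v, P k v /\ simple_right_ext v w); last first.
  by exists (w :: s) => //; apply/MRSE_cons; split=> //; apply/chain_startE.
have [||||c mc cs] := IH v (w :: s) Pv.
- by move=> x; rewrite inE => /orP[/eqP->|/sP].
- by rewrite /= vw.
- by [].
- by case/simple_right_extP: vw szw => b _ ->; rewrite size_rcons.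
by exists c => // x xs; apply: cs; rewrite inE xs orbT.
Qed.

Lemma head_MRSE k : head [::] @` MRSE k = [set` chain_starts k].
Proof.
apply/seteqP; split=> [_ [c mc <-]|w /= /chain_startsP sw].
  by case: c mc => [[]//|u s] /MRSE_cons[_ _ su _]; apply/chain_startsP.
have [s [sP ws sE]] := chain_end_exists _ _ (proj1 sw).
by exists (w :: s) => //; apply/MRSE_cons.
Qed.

Lemma card_eq_uniq (T : choiceType) (s : seq T) : uniq s -> [set` s] #= `I_(size s).
Proof.
case: s => [_|x0 s us]; first by rewrite set_nil card_eq_sym II0.
suff -> : [set` x0 :: s] = nth x0 (x0 :: s) @` `I_(size (x0 :: s)).
  apply: inj_card_eq => i j /set_mem/= il /set_mem/= jl /eqP.
  by rewrite nth_uniq // => /eqP.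
by apply/seteqP; split=> x /= => [/(nthP x0)|] [i il <-]; [exists i|exact: mem_nth].
Qed.

Theorem theorem4 (k : nat) (k_gt0 : 0 < k) :
  [/\ forall w : seq nat, P k w -> exists! c, MRSE k c /\ w \in c,
      partition (MRSE k) (fun c : seq (seq nat) => [set` c]) (P k)
    & MRSE k #= `I_(2 * 3 ^ k.-1)].
Proof.
have MRSE_uniq c c' w : MRSE k c -> MRSE k c' -> w \in c -> w \in c' -> c = c'.
  by move=> mc mc' wc wc'; apply: (MRSE_head_inj k) => //; apply: (MRSE_mem_head k _ _ w).
split.
- move=> w /MRSE_exists[c mc wc]; exists c; split=> // c' [mc' wc'].
  exact: (MRSE_uniq _ _ w).
- split.
  + apply/seteqP; split=> [w [c [_ cP _ _] wc]|w /MRSE_exists[c mc wc]]; first exact: cP.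
    by exists c.
  + by move=> c c' mc mc' [w [/= wc wc']]; exact: (MRSE_uniq _ _ w).
  + by move=> [[]//|u s] _; exists u; rewrite /= inE eqxx.
(* A chain is determined by its first word, so counting chains is counting chain starts. *)
have : head [::] @` MRSE k #= MRSE k.
  apply: inj_card_eq => c c' /set_mem mc /set_mem mc'; exact: (MRSE_head_inj k).
rewrite head_MRSE card_eq_sym => /card_eq_trans; apply.
case: k k_gt0 {MRSE_uniq} => // k _; have [<- _] := size_chain_starts k.
exact/card_eq_uniq/uniq_chain_starts.
Qed.
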